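(* Let $X$ be a compact pointed metric space. On the space $\mathrm{Lip}_0(X)$, the strict topology $\beta$ is the topology $\tau_\gamma$.
   Context: $\mathbb{K}$ is $\mathbb{R}$ or $\mathbb{C}$. $(X,d)$ is a metric space with a distinguished base point $0$. $\mathrm{Lip}_0(X)$ is the Banach space of all Lipschitz functions $f\colon X\to\mathbb{K}$ with $f(0)=0$, with norm $\mathrm{Lip}(f)=\sup\{|f(x)-f(y)|/d(x,y)\colon x,y\in X,\ x\ne y\}$ and closed unit ball $B_{\mathrm{Lip}_0(X)}$. Let $\widetilde X=\{(x,y)\in X^2\colon x\ne y\}$. For $X$ compact, the strict topology $\beta$ on $\mathrm{Lip}_0(X)$ is the locally convex topology generated by the seminorms $\|f\|_\phi=\sup_{(x,y)\in\widetilde X}|\phi(x,y)|\frac{|f(x)-f(y)|}{d(x,y)}$, where $\phi$ runs through the space $C_0(\widetilde X)$ of continuous functions $\widetilde X\to\mathbb{K}$ vanishing at infinity. $\tau_0$ is the compact-open topology on $\mathrm{Lip}_0(X)$ (uniform convergence on compact subsets of $X$). $\tau_\gamma$ is the mixed topology $\gamma[\mathrm{Lip},\tau_0]$ on $\mathrm{Lip}_0(X)$: the locally convex topology having as a base of neighborhoods of zero the sets $\gamma(U)=\bigcup_{n=1}^\infty\left(U_1\cap B_{\mathrm{Lip}_0(X)}+U_2\cap 2B_{\mathrm{Lip}_0(X)}+\cdots+U_n\cap 2^{n-1}B_{\mathrm{Lip}_0(X)}\right)$, where $U=\{U_n\}$ ranges over sequences of convex balanced $\tau_0$-neighborhoods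 of zero. *)

(* Defs.v *)
From HB Require Import structures.
From mathcomp Require Import all_boot all_order all_algebra.
From mathcomp Require Import all_classical all_reals all_analysis.
From mathcomp.real_closed Require Import complex.

Set Implicit Arguments.
Unset Strict Implicit.
Unset Printing Implicit Defensive.

Import Order.TTheory GRing.Theory Num.Theory.
Import numFieldNormedType.Exports.

Local Open Scope classical_set_scope.
Local Open Scope ring_scope.

Section vector_topology.
Context {K : numFieldType} {V : lmodType K}.

Definition balanced (A : set V) :=
  forall (a : K) (f : V), `|a| <= 1 -> A f -> A (a *: f).

(* A base of neighborhoods of zero for a locally convex topology on [V];
   [with_base B] is [V] endowed with that topology, in which the neighborhoods
   of [f] are the sets containing [f + W] for some [W] in [B]. *)
Record zero_base := ZeroBase {
  zero_base_set :> set V -> Prop;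
  zero_base_nonempty : exists A, zero_base_set A;
  zero_base_meet : forall A B, zero_base_set A -> zero_base_set B ->
    exists2 C, zero_base_set C & C `<=` A `&` B;
  zero_base_convex : forall A, zero_base_set A -> convex_set A;
  zero_base_balanced : forall A, zero_base_set A -> balanced A;
  zero_base_absorbing : forall A f, zero_base_set A ->
    \forall a \near (0 : K), A (a *: f);
  zero_base_scale : forall A (a : K), a != 0 -> zero_base_set A ->
    exists2 B, zero_base_set B & forall f, B f -> A (a *: f)
}.

Lemma convex_setP (A : set V) : convex_set A <->
  forall f g (t : K), 0 <= t <= 1 -> A f -> A g -> A (t *: f + (1 - t) *: g).
Proof.
split=> [cA f g t /andP[t0 t1] Af Ag|cA f g t /set_mem Af /set_mem Ag].
  have t01 : Itv.spec (@Itv.num_sem K) (Itv.Real `[0%Z, 1%Z]) t.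
    by rewrite /Itv.num_sem /= in_itv/= t0 t1 ger0_real.
  by have /set_mem := cA f g (Itv.mk t01) (mem_set Af) (mem_set Ag).
by apply/mem_set; apply: cA => //; rewrite ge0 le1.
Qed.

Definition with_base (B : zero_base) : Type := V.

Variable B : zero_base.

HB.instance Definition _ := GRing.Lmodule.on (with_base B).

Definition with_base_nbhs (f : with_base B) : set_system (with_base B) :=
  [set A | exists2 W, B W & forall g, W g -> A (f + g)].

HB.instance Definition _ := hasNbhs.Build (with_base B) with_base_nbhs.

Lemma zero_base0 W : B W -> W 0.
Proof.
move=> BW; rewrite -(scale0r (0 : V)).
by have /nbhs_singleton := zero_base_absorbing 0 BW.
Qed.

Lemma zero_base_half W : B W ->
  exists2 W', B W' & forall f g, W' f -> W' g -> W (f + g).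
Proof.
move=> BW; have n20 : (2 : K) != 0 by rewrite pnatr_eq0.
have [W' BW' W'W] := zero_base_scale n20 BW.
exists W' => // f g W'f W'g.
have /convex_setP := zero_base_convex BW'.
move=> /(_ f g 2^-1); rewrite invr_ge0 ler0n invf_le1 ?ltr0n// ler1n => /(_ isT).
move=> /(_ W'f W'g) /W'W; rewrite scalerDr !scalerA mulrBr mulfV ?pnatr_eq0//.
by rewrite mulr1 -[X in X - 1]/(1 + 1) addrK !scale1r.
Qed.

Let nbhs_proper (f : with_base B) : ProperFilter (nbhs f).
Proof.
split.
  by case=> W /zero_base0 W0 /(_ _ W0).
split.
- by have [W BW] := zero_base_nonempty B; exists W.
- move=> P Q [W BW WP] [W' BW' WQ].
  have [C BC CW] := zero_base_meet BW BW'.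
  by exists C => // g /CW[Wg W'g]; split; [exact: WP|exact: WQ].
- by move=> P Q PQ [W BW WP]; exists W => // g /WP/PQ.
Qed.

Let nbhs_nbhs (f : with_base B) (A : set (with_base B)) :
  nbhs f A -> nbhs f (nbhs^~ A).
Proof.
case=> W BW WA; have [W' BW' W'W] := zero_base_half BW.
exists W' => // g W'g; exists W' => // h W'h.
by rewrite -addrA; apply: WA; exact: W'W.
Qed.

Let with_base_open := [set A : set (with_base B) | A `<=` nbhs^~ A].

Let with_base_nbhsE (f : with_base B) : nbhs f =
  [set A | exists C : set (with_base B),
    [/\ with_base_open C, C f & C `<=` A]].
Proof.
apply/seteqP; split=> A.
  move=> fA; exists (nbhs^~ A); split => //.
    by move=> g; exact: nbhs_nbhs.
  by move=> g [W /zero_base0 W0 /(_ _ W0)]; rewrite addr0.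
move=> [C [oC Cf CA]]; have [W BW WC] := oC _ Cf.
by exists W => // g /WC/CA.
Qed.

HB.instance Definition _ := Nbhs_isTopological.Build (with_base B)
  nbhs_proper with_base_nbhsE erefl.

Let with_base_add : continuous (fun x : with_base B * with_base B => x.1 + x.2).
Proof.
move=> [f g] A /= [W BW WA]; have [W' BW' W'W] := zero_base_half BW.
exists ([set f + h | h in W'], [set g + h | h in W']).
  by split; exists W' => // h W'h; exists h.
move=> [_ _] /= [[h W'h <-] [k W'k <-]].
by rewrite addrACA; apply: WA; exact: W'W.
Qed.

Let with_base_scale :
  continuous (fun z : K^o * with_base B => z.1 *: z.2).
Proof.
move=> [a f] A /= [W BW WA]; have [W' BW' W'W] := zero_base_half BW.
have a1_gt0 : 0 < `|a| + 1 by rewrite ltr_wpDl.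
have [W'' BW'' W''W'] := zero_base_scale (lt0r_neq0 a1_gt0) BW'.
have /nbhs_ballP[e /= e0 abs] := zero_base_absorbing f BW'.
exists (ball (a : K^o) e `&` ball (a : K^o) 1, [set f + h | h in W'']).
  split; last by exists W'' => // h W''h; exists h.
  by apply: filterI; exact: nbhsx_ballx.
move=> [b _] /= [/[swap] [[h W''h <-]]].
rewrite /ball/= => -[abe ab1].
have -> : b *: (f + h) = a *: f + ((b - a) *: f + b *: h).
  by rewrite scalerDr addrA -scalerDl [a + _]addrC subrK.
apply/WA/W'W.
  by apply: abs; rewrite /ball/= sub0r opprB.
have -> : b = (`|a| + 1) * (b / (`|a| + 1)) by rewrite mulrC divfK// gt_eqF.
rewrite -scalerA; apply: W''W'; apply: (zero_base_balanced BW'') => //.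
rewrite normrM normfV (gtr0_norm a1_gt0) ler_pdivrMr// mul1r.
by rewrite -[b](subrK a) (le_trans (ler_normD _ _))// addrC lerD2l distrC ltW.
Qed.

Let with_base_lc : exists2 C : set_system (with_base B),
  (forall A, A \in C -> convex_set A) & basis C.
Proof.
exists [set A | open A /\ convex_set A].
  by move=> A /set_mem[].
split; first by move=> A [].
move=> f A [W BW WA].
exists (nbhs^~ [set f + g | g in W]).
  split; first split.
  - by rewrite openE => g; exact: nbhs_nbhs.
  - apply/convex_setP => g h t t01 [U BU Ug] [U' BU' Uh].
    have [U'' BU'' U''U] := zero_base_meet BU BU'.
    exists U'' => // k /U''U[Uk U'k].
    have [g' Wg' g'E] := Ug _ Uk; have [h' Wh' h'E] := Uh _ U'k.
    exists (t *: g' + (1 - t) *: h').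
      by have /convex_setP := zero_base_convex BW; apply.
    have split1 (u : V) : u = t *: u + (1 - t) *: u.
      by rewrite -scalerDl addrC subrK scale1r.
    rewrite {1}(split1 f) addrACA -!scalerDr g'E h'E !scalerDr addrACA.
    by rewrite -split1.
  - by exists W => // g Wg; exists g.
move=> g /= [U /zero_base0 U0 /(_ _ U0)]; rewrite addr0 => -[h Wh <-].
exact: WA.
Qed.

HB.instance Definition _ := PreTopologicalLmod_isTvs.Build K (with_base B)
  with_base_add with_base_scale with_base_lc.
HB.instance Definition _ :=
  PreTopologicalNmodule_isTopologicalNmodule.Build (with_base B) with_base_add.
HB.instance Definition _ :=
  TopologicalNmodule_isTopologicalLmodule.Build K (with_base B) with_base_scale.
HB.instance Definition _ := Uniform_isTvs.Build K (with_base B) with_base_lc.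

End vector_topology.

Arguments zero_base {K} V.

Inductive scalar_kind := RealScalars | ComplexScalars.

Definition scalars (R : realType) (k : scalar_kind) : numFieldType :=
  match k with RealScalars => R | ComplexScalars => R[i] end.

(* The norm of [scalars R k] takes its values in the field itself; this is the
   same absolute value as an element of [R]. *)
Definition modulus {R : realType} {k : scalar_kind} : scalars R k -> R :=
  match k with
  | RealScalars => fun x : R => `|x|
  | ComplexScalars => fun z : R[i] => complex.Re `|z|
  end.

Section modulus.
Context {R : realType} {k : scalar_kind}.
Implicit Types x y : scalars R k.

Definition of_real : R -> scalars R k :=
  match k with
  | RealScalars => id
  | ComplexScalars => fun r : R => r%:C%C
  end.

Lemma of_real_le : {mono of_real : r s / r <= s}.
Proof. by rewrite /of_real; case: k => r s //=; rewrite ?lecR. Qed.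

Lemma of_real_lt : {mono of_real : r s / r < s}.
Proof. by rewrite /of_real; case: k => r s //=; rewrite ?ltcR. Qed.

Lemma of_realD : {morph of_real : r s / r + s}.
Proof. by rewrite /of_real; case: k => r s //=; rewrite ?raddfD. Qed.

Lemma of_realM : {morph of_real : r s / r * s}.
Proof. by rewrite /of_real; case: k => r s //=; rewrite ?rmorphM. Qed.

Lemma of_real0 : of_real 0 = 0.
Proof. by rewrite /of_real; case: k. Qed.

Lemma of_real1 : of_real 1 = 1.
Proof. by rewrite /of_real; case: k. Qed.

Lemma of_real_inj : injective of_real.
Proof. by move=> r s rs; apply/eqP; rewrite eq_le -!of_real_le rs lexx. Qed.

Lemma normE x : `|x| = of_real (modulus x).
Proof. by rewrite /of_real /modulus; case: k x. Qed.

Lemma modulus_ge0 x : 0 <= modulus x.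
Proof. by rewrite -of_real_le of_real0 -normE. Qed.

Lemma modulus0 : modulus (0 : scalars R k) = 0.
Proof. by apply: of_real_inj; rewrite -normE normr0 of_real0. Qed.

Lemma modulusM x y : modulus (x * y) = modulus x * modulus y.
Proof. by apply: of_real_inj; rewrite of_realM -!normE normrM. Qed.

Lemma ler_modulusD x y : modulus (x + y) <= modulus x + modulus y.
Proof. by rewrite -of_real_le of_realD -!normE ler_normD. Qed.

Lemma modulus_le1 x : (modulus x <= 1) = (`|x| <= 1).
Proof. by rewrite normE -of_real1 of_real_le. Qed.

Lemma modulus_conv x : 0 <= x <= 1 -> modulus x + modulus (1 - x) = 1.
Proof.
move=> /andP[x0 x1]; apply: of_real_inj; rewrite of_realD of_real1 -!normE.
by rewrite !ger0_norm ?subr_ge0// addrC subrK.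
Qed.

Lemma near_modulus x (e : R) : 0 < e -> \forall y \near x, modulus (y - x) < e.
Proof.
move=> e0; apply/nbhs_ballP; exists (of_real e) => /=.
  by rewrite -of_real0 of_real_lt.
by move=> y; rewrite /ball/= distrC normE of_real_lt.
Qed.

End modulus.

Section lip0.
Context {R : realType} (k : scalar_kind) {X : metricType R} (o : X).
Local Notation K := (scalars R k).

Definition lipschitz0 : pred (X -> K^o) := [pred f | `[< f o = 0 /\
  exists L : R, forall x y, modulus (f x - f y : K) <= L * mdist x y >]].

Record lip0 := Lip0 { lip0_fun :> X -> K^o; _ : lip0_fun \in lipschitz0 }.

HB.instance Definition _ := [isSub for lip0_fun].
HB.instance Definition _ := [Choice of lip0 by <:].

Lemma lipschitz0_submod_closed : submod_closed lipschitz0.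
Proof.
split.
  apply/asboolP; split => //; exists 0 => x y.
  by rewrite mul0r subrr modulus0.
move=> a f g /asboolP[f0 [L fL]] /asboolP[g0 [M gM]].
apply/asboolP; split.
  by rewrite -[LHS]/(a * f o + g o) f0 g0 mulr0 addr0.
exists (modulus a * L + M) => x y.
have -> : (a *: f + g) x - (a *: f + g) y = a * (f x - f y) + (g x - g y).
  by rewrite -[LHS]/(a * f x + g x - (a * f y + g y)) mulrBr opprD addrACA.
rewrite (le_trans (ler_modulusD _ _))// mulrDl lerD// modulusM -mulrA.
by rewrite ler_wpM2l// modulus_ge0.
Qed.

HB.instance Definition _ := GRing.isSubmodClosed.Build K (X -> K^o) lipschitz0
  lipschitz0_submod_closed.
HB.instance Definition _ := [SubChoice_isSubLmodule of lip0 by <:].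

Definition offdiag : set (X * X) := [set p | p.1 <> p.2].

Definition slope (f : lip0) (p : X * X) : R :=
  modulus (f p.1 - f p.2 : K) / mdist p.1 p.2.

(* The sets below are bounded above, and [sup set0 = 0] gives the right values
   when [X] is a singleton. *)
Definition Lip (f : lip0) : R := sup [set slope f p | p in offdiag].

Definition lip0_ball : set lip0 := [set f | Lip f <= 1].

(* [offdiag] coerces to the subtype of [X * X], with the subspace topology. *)
Definition C0_offdiag : set (offdiag -> K) := [set phi | continuous phi /\
  forall e : R, 0 < e -> exists2 C : set offdiag, compact C &
    forall p, ~ C p -> modulus (phi p) < e].

Definition strict_seminorm (phi : offdiag -> K) (f : lip0) : R :=
  sup [set modulus (phi p) * slope f (\val p) | p in [set: offdiag]].

(* The finite intersections of balls of the seminorms. *)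
Definition strict_nbhs0 : set (set lip0) := [set W |
  exists n (phi : 'I_n -> offdiag -> K) (e : R),
    [/\ forall i, C0_offdiag (phi i), 0 < e &
        W = [set f | forall i, strict_seminorm (phi i) f < e]]].

Definition lip0_compact_open : topologicalType :=
  initial_topology (lip0_fun : lip0 -> {compact-open, X -> K}).

(* The index [n] starts from 0, so that [U n] is the U_{n+1} of the usual
   presentation. *)
Definition mixed_set (U : nat -> set lip0) : set lip0 := \bigcup_n [set f |
  exists2 g : nat -> lip0,
    forall i, (i <= n)%N -> (U i `&` [set 2 ^+ i *: h | h in lip0_ball]) (g i) &
    f = \sum_(i < n.+1) g i].

Definition mixed_seq (U : nat -> set lip0) := forall n,
  [/\ convex_set (U n), balanced (U n) & nbhs (0 : lip0_compact_open) (U n)].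

Definition mixed_nbhs0 : set (set lip0) := [set W |
  exists2 U : nat -> set lip0, mixed_seq U & W = mixed_set U].

Lemma sup_le (A : set R) (r : R) : 0 <= r -> ubound A r -> sup A <= r.
Proof.
move=> r0 Ar; have [->|/set0P A0] := eqVneq A set0; first by rewrite sup0.
exact: ge_sup.
Qed.

Lemma slope_ge0 f p : 0 <= slope f p.
Proof. by rewrite divr_ge0 ?modulus_ge0 ?mdist_ge0. Qed.

Lemma slopeD f g p : slope (f + g) p <= slope f p + slope g p.
Proof.
rewrite /slope -mulrDl ler_wpM2r ?invr_ge0 ?mdist_ge0//.
have -> : (f + g) p.1 - (f + g) p.2 = (f p.1 - f p.2) + (g p.1 - g p.2) :> K.
  by rewrite -[LHS]/(f p.1 + g p.1 - (f p.2 + g p.2)) opprD addrACA.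
exact: ler_modulusD.
Qed.

Lemma slopeZ (a : K) f p : slope (a *: f) p = modulus a * slope f p.
Proof.
rewrite /slope mulrA -modulusM mulrBr.
by congr (modulus _ / _).
Qed.

Lemma slope0 p : slope 0 p = 0.
Proof. by rewrite -(scale0r (0 : lip0)) slopeZ modulus0 mul0r. Qed.

Lemma slope_bounded f :
  exists2 L : R, 0 <= L & forall p, offdiag p -> slope f p <= L.
Proof.
case: f => f /= fl; have /asboolP[_ [L fL]] := fl.
exists `|L| => // p pd.
have p0 : 0 < mdist p.1 p.2 by rewrite mdist_gt0; exact/eqP.
rewrite /slope ler_pdivrMr// (le_trans (fL _ _))// ler_wpM2r ?mdist_ge0//.
exact: ler_norm.
Qed.

Lemma Lip_leP f r : 0 <= r -> Lip f <= r <-> forall p, offdiag p -> slope f p <= r.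
Proof.
move=> r0; split=> [fr p pd|fr]; last by apply: sup_le => // _ [p pd <-]; exact: fr.
apply: le_trans fr; apply: ub_le_sup; last by exists p.
by have [L _ fL] := slope_bounded f; exists L => _ [q qd <-]; exact: fL.
Qed.

Lemma lip0_ballZP n f : [set 2 ^+ n *: h | h in lip0_ball] f <->
  forall p, offdiag p -> slope f p <= 2 ^+ n.
Proof.
have m2 : modulus (2 ^+ n : K) = 2 ^+ n.
  elim: n => [|n IH]; last first.
    rewrite !exprS modulusM IH; congr (_ * _).
    apply: (of_real_inj (k := k)); rewrite -normE normr_nat.
    by rewrite -[X in of_real X]/(1 + 1) of_realD of_real1.
  by rewrite !expr0; apply: (of_real_inj (k := k)); rewrite -normE normr1 of_real1.
have n0 : (2 ^+ n : K) != 0 by rewrite expf_neq0// pnatr_eq0.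
split=> [[h /Lip_leP hB <-] p pd|fn].
  by rewrite slopeZ m2 ler_piMr ?exprn_ge0//; exact: hB.
exists ((2 ^+ n)^-1 *: f); last by rewrite scalerA mulfV// scale1r.
apply/Lip_leP => // p pd.
have : slope (2 ^+ n *: ((2 ^+ n)^-1 *: f)) p <= 2 ^+ n.
  by rewrite scalerA mulfV// scale1r; exact: fn.
by rewrite slopeZ m2 ger_pMr// exprn_gt0.
Qed.

Lemma C0_bounded phi : C0_offdiag phi ->
  exists2 M : R, 0 <= M & forall p, modulus (phi p) <= M.
Proof.
move=> [cphi /(_ 1 ltr01)[C /compact_near_coveringP cC C1]].
have /filter_ex[M CM] : \forall M \near +oo%R, C `<=` (fun p => modulus (phi p) < M).
  apply: (cC R +oo%R (fun M p => modulus (phi p) < M)) => p Cp.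
  have : \forall q \near p, modulus (phi q) < modulus (phi p) + 1.
    have : \forall q \near p, modulus (phi q - phi p) < 1.
      exact: cphi (near_modulus (phi p) ltr01).
    apply: filterS => q qp; rewrite -[phi q](subrK (phi p)).
    by rewrite (le_lt_trans (ler_modulusD _ _))// addrC ltrD2l.
  move=> pq; exists ([set q | modulus (phi q) < modulus (phi p) + 1],
      [set M | modulus (phi p) + 1 < M]) => /=.
    by split => //; apply: nbhs_pinfty_gt; exact: num_real.
  by move=> [q N] /= [/lt_trans qN /qN].
exists (`|M| + 1); first by rewrite addr_ge0.
move=> p; have [Cp|nCp] := pselect (C p).
  by rewrite (le_trans (ltW (CM _ Cp)))// (le_trans (ler_norm M))// lerDl.
by rewrite (le_trans (ltW (C1 _ nCp)))// lerDr.
Qed.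

Section strict_seminorm.
Variables (phi : offdiag -> K) (C0phi : C0_offdiag phi).
Local Notation q := (strict_seminorm phi).

Lemma strict_seminorm_ub f p : modulus (phi p) * slope f (\val p) <= q f.
Proof.
apply: ub_le_sup; last by exists p.
have [M M0 phiM] := C0_bounded C0phi; have [L L0 fL] := slope_bounded f.
exists (M * L) => _ [r _ <-].
by rewrite ler_pM ?modulus_ge0 ?slope_ge0//; apply: fL; exact/set_valP.
Qed.

Lemma strict_seminorm_ge0 f : 0 <= q f.
Proof.
have [[p pd]|/forallNP d0] := pselect (exists p, offdiag p).
  apply: le_trans (strict_seminorm_ub f (SigSub (mem_set pd))).
  by rewrite mulr_ge0 ?modulus_ge0 ?slope_ge0.
rewrite /strict_seminorm (_ : [set _ | _ in _] = set0) ?sup0//.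
by apply/seteqP; split=> // r [p _ _]; exact: d0 (set_valP p).
Qed.

Lemma strict_seminormD f g : q (f + g) <= q f + q g.
Proof.
apply: sup_le; first by rewrite addr_ge0 ?strict_seminorm_ge0.
move=> _ [p _ <-].
apply: le_trans (lerD (strict_seminorm_ub f p) (strict_seminorm_ub g p)).
by rewrite -mulrDr ler_wpM2l ?modulus_ge0 ?slopeD.
Qed.

Lemma strict_seminormZ (a : K) f : q (a *: f) <= modulus a * q f.
Proof.
apply: sup_le; first by rewrite mulr_ge0 ?modulus_ge0 ?strict_seminorm_ge0.
move=> _ [p _ <-]; rewrite slopeZ mulrCA.
by rewrite ler_wpM2l ?modulus_ge0 ?strict_seminorm_ub.
Qed.

End strict_seminorm.

Lemma strict_nbhs0_nonempty : exists W, strict_nbhs0 W.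
Proof.
by exists setT, 0%N, (fun=> cst 0), 1; split=> [[]//|//|]; apply/esym/seteqP; split=> // f _ [].
Qed.

Lemma strict_nbhs0_meet A B : strict_nbhs0 A -> strict_nbhs0 B ->
  exists2 C, strict_nbhs0 C & C `<=` A `&` B.
Proof.
move=> [n [phi [e [phi0 e0 ->]]]] [m [psi [d [psi0 d0 ->]]]].
pose u i := match fintype.split i with inl i => phi i | inr j => psi j end.
exists [set f | forall i : 'I_(n + m), strict_seminorm (u i) f < Num.min e d].
  exists (n + m)%N, u, (Num.min e d); split => //; last by rewrite lt_min e0.
  by move=> i; rewrite /u; case: fintype.split.
move=> f fu; split=> i.
  by have := fu (unsplit (inl i)); rewrite /u unsplitK lt_min => /andP[].
by have := fu (unsplit (inr i)); rewrite /u unsplitK lt_min => /andP[].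
Qed.

Lemma strict_nbhs0_convex A : strict_nbhs0 A -> convex_set A.
Proof.
move=> [n [phi [e [phi0 e0 ->]]]]; apply/convex_setP => f g t t01 fe ge i.
have {}fe := fe i; have {}ge := ge i.
pose M := Num.max (strict_seminorm (phi i) f) (strict_seminorm (phi i) g).
have Me : M < e by rewrite gt_max fe.
apply: le_lt_trans Me; rewrite (le_trans (strict_seminormD _ _ _))//.
rewrite -[leRHS]mul1r -(modulus_conv t01) mulrDl.
by apply: lerD; (apply: le_trans (strict_seminormZ _ _ _) _; first by []);
  rewrite ler_wpM2l ?modulus_ge0// le_max lexx ?orbT.
Qed.

Lemma strict_nbhs0_balanced A : strict_nbhs0 A -> balanced A.
Proof.
move=> [n [phi [e [phi0 e0 ->]]]] a f; rewrite -modulus_le1 => a1 fe i.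
apply: le_lt_trans (fe i); apply: le_trans (strict_seminormZ _ _ _) _ => //.
by rewrite ler_piMl ?strict_seminorm_ge0.
Qed.

Lemma strict_nbhs0_absorbing A f : strict_nbhs0 A ->
  \forall a \near (0 : K), A (a *: f).
Proof.
move=> [n [phi [e [phi0 e0 ->]]]].
suff H i : \forall a \near (0 : K), strict_seminorm (phi i) (a *: f) < e.
  by have := filter_forall (nbhs_filter (0 : K)) H.
have q1 : 0 < strict_seminorm (phi i) f + 1.
  by rewrite ltr_wpDl ?strict_seminorm_ge0.
have : \forall a \near (0 : K), modulus a < e / (strict_seminorm (phi i) f + 1).
  have := near_modulus (0 : K) (divr_gt0 e0 q1).
  by apply: filterS => a; rewrite subr0.
apply: filterS => a; rewrite ltr_pdivlMr// => ae.
apply: le_lt_trans ae; apply: le_trans (strict_seminormZ _ _ _) _ => //.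
by rewrite ler_wpM2l ?modulus_ge0// lerDl.
Qed.

Lemma strict_nbhs0_scale A (a : K) : a != 0 -> strict_nbhs0 A ->
  exists2 B, strict_nbhs0 B & forall f, B f -> A (a *: f).
Proof.
move=> a0 [n [phi [e [phi0 e0 ->]]]].
have ma : 0 < modulus a by rewrite -(of_real_lt (k := k)) of_real0 -normE normr_gt0.
exists [set f | forall i, strict_seminorm (phi i) f < e / modulus a].
  by exists n, phi, (e / modulus a); split; rewrite ?divr_gt0.
move=> f fe i; apply: le_lt_trans (strict_seminormZ _ _ _) _ => //.
by rewrite -ltr_pdivlMl// mulrC.
Qed.

Definition strict_base : zero_base lip0 :=
  ZeroBase strict_nbhs0_nonempty strict_nbhs0_meet strict_nbhs0_convex
    strict_nbhs0_balanced strict_nbhs0_absorbing strict_nbhs0_scale.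

Definition strict_lip0 : tvsType K := with_base strict_base.

Lemma compact_open_nbhs0 T (F : set_system T) (h : T -> lip0) (U : set lip0) :
  Filter F ->
  (forall C (O : set K), compact C -> open O -> (C !=set0 -> O 0) ->
    F [set t | forall x, C x -> O (h t x)]) ->
  nbhs (0 : lip0_compact_open) U -> F [set t | U (h t)].
Proof.
move=> FF hF [_ [[A oA <-] A0 AU]].
pose g (t : T) : {compact-open, X -> K} := lip0_fun (h t).
suff gF : g @ F --> (lip0_fun 0 : {compact-open, X -> K}).
  have gFA : F (g @^-1` A) := gF A (open_nbhs_nbhs (conj oA A0)).
  exact: (filterS (fun t => AU (h t)) gFA).
apply/compact_open_cvgP => C O cC oO CO.
have C0 : C !=set0 -> O 0 by move=> [x Cx]; apply: CO; exists x.
suff sub : [set t | forall x, C x -> O (h t x)] `<=` [set t | g t @` C `<=` O].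
  exact: (filterS sub (hF C O cC oO C0)).
by move=> t hO _ [x Cx <-]; exact: hO.
Qed.

Lemma lip0_continuous (f : lip0) : continuous (f : X -> K).
Proof.
case: f => f /= fl; have /asboolP[_ [L fL]] := fl.
move=> x A /nbhs_ballP[e /= e0 eA].
have me : 0 < modulus e.
  by rewrite -(of_real_lt (k := k)) of_real0 -normE normr_gt0 gt_eqF.
have L1 : 0 < `|L| + 1 by rewrite ltr_wpDl.
have : nbhs x (ball x (modulus e / (`|L| + 1))).
  by apply: nbhsx_ballx; rewrite divr_gt0.
apply: filterS => y; rewrite ballEmdist/= ltr_pdivlMr// => xy.
apply: eA; rewrite /ball/= -(gtr0_norm e0) !normE of_real_lt.
apply: le_lt_trans xy; rewrite (le_trans (fL _ _))// mulrC.
by rewrite ler_wpM2l ?mdist_ge0// (le_trans (ler_norm L))// lerDl.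
Qed.

Lemma compact_open_scale (a : K) (U : set lip0) :
  nbhs (0 : lip0_compact_open) U ->
  nbhs (0 : lip0_compact_open) [set f | U (a *: f)].
Proof.
apply: (compact_open_nbhs0 (F := nbhs (0 : lip0_compact_open))) => C O cC oO C0.
pose O' : set K := [set z | O (a * z)].
have oO' : open O'.
  apply: (@open_comp K K ( *%R a) O) => // z _.
  by apply: (@mulrl_continuous K a).
have := compact_open_open cC oO'.
exists (lip0_fun @^-1` [set g | g @` C `<=` O']); split.
- by eexists; first exact: (compact_open_open cC oO').
- by move=> _ [x Cx <-]; rewrite /O' /= mulr0; apply: C0; exists x.
- by move=> f fO x Cx; apply: fO; exists x.
Qed.

Lemma compact_open_absorbing (f : lip0) (U : set lip0) :
  nbhs (0 : lip0_compact_open) U -> \forall a \near (0 : K), U (a *: f).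
Proof.
apply: (compact_open_nbhs0 (F := nbhs (0 : K))).
move=> C O /compact_near_coveringP cC oO C0.
apply: (cC K (nbhs (0 : K)) (fun a x => O (a * f x))) => x Cx.
have : (fun p : X * K => p.2 * f p.1 : K) @ (x, 0) --> (0 * f x : K).
  apply: (@cvgM K _ _ _ snd (fun p => f p.1)); first exact: cvg_snd.
  apply: (@cvg_comp _ _ _ fst (f : X -> K) _ (nbhs x)); first exact: cvg_fst.
  exact: lip0_continuous.
apply; rewrite mul0r; apply: open_nbhs_nbhs; split => //; apply: C0; by exists x.
Qed.

Lemma lip0_ballZ_convex n : convex_set [set 2 ^+ n *: h | h in lip0_ball].
Proof.
apply/convex_setP => f g t t01 /lip0_ballZP fn /lip0_ballZP gn.
apply/lip0_ballZP => p pd; rewrite (le_trans (slopeD _ _ _))// !slopeZ.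
have -> : 2 ^+ n = (modulus t + modulus (1 - t)) * 2 ^+ n :> R.
  by rewrite modulus_conv// mul1r.
by rewrite mulrDl lerD// ler_wpM2l ?modulus_ge0 ?fn ?gn.
Qed.

Lemma lip0_ballZ_balanced n : balanced [set 2 ^+ n *: h | h in lip0_ball].
Proof.
move=> a f; rewrite -modulus_le1 => a1 /lip0_ballZP fn.
apply/lip0_ballZP => p pd; rewrite slopeZ (le_trans _ (fn p pd))//.
by rewrite ler_piMl ?slope_ge0.
Qed.

Lemma mixed_seq0 U n : mixed_seq U -> U n 0.
Proof. by case/(_ n) => _ _ /nbhs_singleton. Qed.

Lemma lip0_ballZ0 n : [set 2 ^+ n *: h | h in lip0_ball] 0.
Proof. by apply/lip0_ballZP => p _; rewrite slope0 exprn_ge0. Qed.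

Lemma mixed_setP U f : mixed_seq U -> mixed_set U f <->
  exists N, forall n, (N <= n)%N -> exists2 g : nat -> lip0,
    forall i, (i <= n)%N -> (U i `&` [set 2 ^+ i *: h | h in lip0_ball]) (g i) &
    f = \sum_(i < n.+1) g i.
Proof.
move=> mU; split=> [[N _ [g gU fg]]|[N /(_ N (leqnn N)) H]]; last by exists N.
exists N => n Nn; exists (fun i => if (i <= N)%N then g i else 0) => [i _|].
  case: ifP => [iN|_]; first exact: gU.
  by split; [exact: mixed_seq0|exact: lip0_ballZ0].
rewrite fg (big_ord_widen n.+1 g)// big_mkcond/=.
by apply: eq_bigr => i _; rewrite ltnS.
Qed.

Lemma mixed_nbhs0_nonempty : exists W, mixed_nbhs0 W.
Proof.
exists (mixed_set (fun=> setT)), (fun=> setT) => // n; split=> //.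
exact: (filterT (F := nbhs (0 : lip0_compact_open))).
Qed.

Lemma mixed_nbhs0_meet A B : mixed_nbhs0 A -> mixed_nbhs0 B ->
  exists2 C, mixed_nbhs0 C & C `<=` A `&` B.
Proof.
move=> [U mU ->] [V mV ->].
exists (mixed_set (fun n => U n `&` V n)).
  exists (fun n => U n `&` V n) => // n.
  have [cU bU nU] := mU n; have [cV bV nV] := mV n; split.
  - apply/convex_setP => f g t t01 [Uf Vf] [Ug Vg].
    by split; [move/convex_setP: cU|move/convex_setP: cV]; apply.
  - by move=> a f a1 [Uf Vf]; split; [exact: bU|exact: bV].
  - exact: (filterI (F := nbhs (0 : lip0_compact_open))).
move=> f [n _ [g gU fg]].
by split; exists n => //; exists g => // i /gU [[]].
Qed.

Lemma mixed_nbhs0_convex A : mixed_nbhs0 A -> convex_set A.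
Proof.
move=> [U mU ->]; apply/convex_setP => f f' t t01.
move=> /(mixed_setP _ mU)[N fN] /(mixed_setP _ mU)[N' fN'].
have [g gU ->] := fN (maxn N N') (leq_maxl _ _).
have [g' gU' ->] := fN' (maxn N N') (leq_maxr _ _).
exists (maxn N N') => //; exists (fun i => t *: g i + (1 - t) *: g' i).
  move=> i im; have [Ui Bi] := gU i im; have [Ui' Bi'] := gU' i im.
  have [/convex_setP cU _ _] := mU i; split; first exact: cU.
  by have /convex_setP := @lip0_ballZ_convex i; apply.
by rewrite !scaler_sumr -big_split.
Qed.

Lemma mixed_nbhs0_balanced A : mixed_nbhs0 A -> balanced A.
Proof.
move=> [U mU ->] a f a1 [n _ [g gU ->]].
exists n => //; exists (fun i => a *: g i); last by rewrite scaler_sumr.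
move=> i /gU[Ui Bi]; have [_ bU _] := mU i.
by split; [exact: bU|exact: lip0_ballZ_balanced].
Qed.

Lemma mixed_nbhs0_absorbing A f : mixed_nbhs0 A ->
  \forall a \near (0 : K), A (a *: f).
Proof.
move=> [U mU ->]; have [_ _ nU] := mU 0%N.
have [L L0 fL] := slope_bounded f.
have L1 : 0 < (L + 1)^-1 by rewrite invr_gt0 ltr_wpDl.
suff sub a : U 0%N (a *: f) -> modulus (a - 0) < (L + 1)^-1 ->
    mixed_set U (a *: f).
  near=> a; apply: sub; near: a; first exact: compact_open_absorbing.
  exact: near_modulus.
rewrite subr0 => Ua aL.
exists 0%N => //; exists (fun=> a *: f); last by rewrite big_ord1.
move=> i; rewrite leqn0 => /eqP ->; split => //; apply/lip0_ballZP => p pd.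
rewrite slopeZ expr0 (@le_trans _ _ ((L + 1)^-1 * (L + 1)))//.
  by rewrite ler_pM ?modulus_ge0 ?slope_ge0 ?(ltW aL)// (le_trans (fL p pd))// lerDl.
by rewrite mulVf// gt_eqF// ltr_wpDl.
Unshelve. all: by end_near.
Qed.

Lemma mixed_nbhs0_scale A (a : K) : a != 0 -> mixed_nbhs0 A ->
  exists2 B, mixed_nbhs0 B & forall f, B f -> A (a *: f).
Proof.
move=> a0 [U mU ->].
have [m am] : exists m, modulus a <= 2 ^+ m.
  exists (Num.bound (modulus a)); apply: ltW.
  apply: lt_le_trans (archi_boundP (modulus_ge0 a)) _.
  by rewrite -natrX ler_nat ltnW// ltn_expl.
pose V n := [set f | U (m + n)%N (a *: f)].
exists (mixed_set V).
  exists V => // n; have [cU bU nU] := mU (m + n)%N; split.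
  - apply/convex_setP => f g t t01 Vf Vg; rewrite /V /=.
    rewrite scalerDr !scalerA ![a * _]mulrC -!scalerA.
    by move/convex_setP: cU; apply.
  - move=> b f b1 Vf; rewrite /V /= scalerA mulrC -scalerA.
    exact: bU.
  - exact: compact_open_scale.
move=> _ [n _ [g gV ->]].
exists (m + n)%N => //.
exists (fun i => if (m <= i)%N then a *: g (i - m)%N else 0) => [i imn|].
  case: ifP => [mi|_]; last by split; [exact: mixed_seq0|exact: lip0_ballZ0].
  have [] : (V (i - m)%N `&` [set 2 ^+ (i - m)%N *: h | h in lip0_ball]) (g (i - m)%N).
    by apply: gV; rewrite leq_subLR.
  rewrite /V /= subnKC// => Ui /lip0_ballZP gi; split=> //.
  apply/lip0_ballZP => p pd; rewrite slopeZ -{2}(subnKC mi) exprD.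
  by rewrite ler_pM ?modulus_ge0 ?slope_ge0//; exact: gi.
rewrite -addnS big_split_ord/= [X in X + _]big1 ?add0r => [|i _]; last first.
  by rewrite leqNgt ltn_ord.
by rewrite scaler_sumr; apply: eq_bigr => i _; rewrite leq_addr addKn.
Qed.

Definition mixed_base : zero_base lip0 :=
  ZeroBase mixed_nbhs0_nonempty mixed_nbhs0_meet mixed_nbhs0_convex
    mixed_nbhs0_balanced mixed_nbhs0_absorbing mixed_nbhs0_scale.

Definition mixed_lip0 : tvsType K := with_base mixed_base.

End lip0.

(* Main.v *)
Require Import Defs.
From mathcomp Require Import all_boot all_order all_algebra.
From mathcomp Require Import all_classical all_reals all_analysis.
From mathcomp.real_closed Require Import complex.
From mathcomp Require Import ring lra.

Set Implicit Arguments.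
Unset Strict Implicit.
Unset Printing Implicit Defensive.

Import Order.TTheory GRing.Theory Num.Theory.
Import numFieldNormedType.Exports.

Local Open Scope classical_set_scope.
Local Open Scope ring_scope.

(** Write [d] for the distance of [X] and [B] for the unit ball of Lip_0(X).
    Both topologies are given by bases of neighborhoods of zero, so it is enough
    that each basic neighborhood of either topology contains one of the other.
    Since [X] is compact, the compact-open neighborhoods of zero are the sets
    that contain a ball of the uniform norm ([nbhs0_compact_openP]).

    Mixed inside strict.  Let phi be in C_0.  On [2^n B] the weighted slopes are
    uniformly small off a compact set of pairs, where phi is small; on that
    compact set [d] is bounded below, so the slopes are small once the uniform
    norm is.  Hence there is a uniform ball [U n] such that the seminorm of phi
    is at most [e / 2^(n+2)] on the intersection of [U n] and [2^n B], and
    summing over [n] shows that the seminorm stays below [e] on [mixed_set U]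
    ([mixed_nbhs0_strict_seminorm]).

    Strict inside mixed.  Let [U n] contain the uniform ball of radius [eta n],
    and choose [delta n > 0] below [eta n] and [eta n.+1].  The function
    [phi (x, y) = sup_n d(x, y) / (2^n d(x, y) + delta n)] is in C_0
    ([C0_offdiag_weight]), and a bound [c] on its seminorm at [f] says exactly
    that [|f x - f y| <= c (2^n d(x, y) + delta n)] for all [n].  For each [n],
    such an [f] is within a multiple of [c * delta n] of a function [F n] whose
    Lipschitz constant is a multiple of [c * 2^n]; inf-convolution of the real
    and imaginary parts with [c * 2^n * d] provides it
    ([lip0_lipschitz_approx]).  As [f] is Lipschitz, [F N = f] may be taken for
    large [N].  The telescoping sum [f = F 0 + (F 1 - F 0) + ...] up to [N] then
    puts [f] in [mixed_set U] when [c] is small ([mixed_set_telescope]). *)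

(** * Moduli and parts of scalars *)

Lemma exp2_cofinal (R : realType) (r : R) : 0 <= r -> exists n, r <= 2 ^+ n.
Proof.
move=> r0; exists (Num.bound r); apply: ltW.
apply: lt_le_trans (archi_boundP r0) _.
by rewrite -natrX ler_nat ltnW// ltn_expl.
Qed.

Section scalar_parts.
Context {R : realType} {k : scalar_kind}.
Local Notation K := (scalars R k).
Implicit Types z w : K.

(** Inf-convolution needs real-valued functions.  Splitting scalars into two
    real parts treats both scalar fields at once, the imaginary part being zero in
    the real case. *)
Definition re_part : K -> R :=
  match k with RealScalars => id | ComplexScalars => @complex.Re R end.

Definition im_part : K -> R :=
  match k with RealScalars => fun=> 0 | ComplexScalars => @complex.Im R end.

Definition of_parts : R -> R -> K :=
  match k with RealScalars => fun a _ => a | ComplexScalars => @Complex R end.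

Lemma re_partB z w : re_part (z - w) = re_part z - re_part w.
Proof.
by rewrite /re_part; move: z w; case: k => z w //=; rewrite raddfB.
Qed.

Lemma im_partB z w : im_part (z - w) = im_part z - im_part w.
Proof.
by rewrite /im_part; move: z w; case: k => z w //=; rewrite ?subr0 ?raddfB.
Qed.

Lemma of_partsB a b a' b' :
  of_parts a b - of_parts a' b' = of_parts (a - a') (b - b').
Proof. by rewrite /of_parts; case: k. Qed.

Lemma of_partsK z : of_parts (re_part z) (im_part z) = z.
Proof. by rewrite /of_parts /re_part /im_part; move: z; case: k => // -[]. Qed.

Lemma ler_norm_re_part z : `|re_part z| <= modulus z.
Proof.
rewrite /modulus /re_part; move: z; case: k => //= -[a b] /=.
by rewrite -sqrtr_sqr ler_wsqrtr// lerDl sqr_ge0.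
Qed.

Lemma ler_norm_im_part z : `|im_part z| <= modulus z.
Proof.
rewrite /modulus /im_part; move: z; case: k => /= [z|[a b] /=].
  by rewrite normr0.
by rewrite -sqrtr_sqr ler_wsqrtr// lerDr sqr_ge0.
Qed.

Lemma ler_modulus_parts a b : modulus (of_parts a b) <= `|a| + `|b|.
Proof.
rewrite /modulus /of_parts; case: k => /=; first by rewrite lerDl.
rewrite -[leRHS]ger0_norm ?addr_ge0// -sqrtr_sqr ler_wsqrtr//.
rewrite sqrrD !real_normK ?num_real// -addrA lerD2l lerDr.
by rewrite mulrn_wge0// mulr_ge0.
Qed.

Lemma modulusBC z w : modulus (z - w) = modulus (w - z).
Proof. by apply: (of_real_inj (k := k)); rewrite -!normE distrC. Qed.

Lemma modulus_of_real (r : R) : modulus (of_real r : K) = `|r|.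
Proof.
rewrite /modulus /of_real; case: k => //=.
by rewrite expr0n /= addr0 sqrtr_sqr.
Qed.

Lemma ler_modulusB z w : modulus (z - w) <= modulus z + modulus w.
Proof.
by apply: le_trans (ler_modulusD _ _) _; rewrite -[- w]sub0r modulusBC subr0.
Qed.

Lemma ler_modulus_dist z w w' :
  modulus (w - w') <= modulus (z - w) + modulus (z - w').
Proof.
have -> : w - w' = (z - w') - (z - w) by ring.
by rewrite [leRHS]addrC ler_modulusB.
Qed.

Lemma ler_modulusBB z z' w w' :
  modulus ((z - z') - (w - w')) <= modulus (z - w) + modulus (z' - w').
Proof.
have -> : (z - z') - (w - w') = (z - w) - (z' - w') by ring.
exact: ler_modulusB.
Qed.

End scalar_parts.

(** * Approximation by functions with smaller Lipschitz constant *)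

Section inf_convolution.
Context {R : realType} {X : metricType R}.

(** The inf-convolution [x |-> inf_y (u y + M d(x, y))] is [M]-Lipschitz as
    an infimum of such functions and lies below [u]; the hypothesis on [u] says
    precisely that it is at least [u - b]. *)
Lemma inf_convolution (u : X -> R) (M b : R) : 0 <= M ->
    (forall x y, u x - u y <= M * mdist x y + b) ->
  exists v : X -> R, (forall x y, v x - v y <= M * mdist x y) /\
    (forall x, u x - b <= v x <= u x).
Proof.
move=> M0 uM; pose S x := [set u y + M * mdist x y | y in [set: X]].
have Slb x : lbound (S x) (u x - b).
  by move=> _ [y _ <-]; have := uM x y; lra.
have S0 x : S x !=set0 by exists (u x + M * mdist x x), x.
have Sinf x y : inf (S x) <= u y + M * mdist x y.
  by apply: ge_inf; [exists (u x - b)|exists y].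
exists (fun x => inf (S x)); split=> [x y|x].
  rewrite lerBlDr -lerBlDl; apply: lb_le_inf => // _ [z _ <-].
  have := Sinf x z; have := metric_triangle x y z.
  by move=> /(ler_wpM2l M0); lra.
rewrite lb_le_inf//=; have := Sinf x x.
by rewrite mdistxx mulr0 addr0.
Qed.

End inf_convolution.

Section lip0_topologies.
Context {R : realType} (k : scalar_kind) {X : metricType R} (o : X).
Local Notation K := (scalars R k).
Local Notation L0 := (lip0 k o).

Lemma lip0_at_base (f : L0) : f o = 0.
Proof. by case: f => f /= fl; have /asboolP[] := fl. Qed.

(** Both factors 2 account for the two real parts of a scalar.  Subtracting
    the value at the base point costs nothing more: the difference between [u]
    and its inf-convolution has values in an interval of length [b], so its
    increments are at most [b]. *)
Lemma lip0_lipschitz_approx (f : L0) (M b : R) : 0 <= M ->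
    (forall x y, modulus (f x - f y : K) <= M * mdist x y + b) ->
  exists g : L0, (forall x y, modulus (g x - g y : K) <= 2 * M * mdist x y) /\
    (forall x, modulus (f x - g x : K) <= 2 * b).
Proof.
move=> M0 fM.
have [v [vM uv]] : exists v : X -> R,
    (forall x y, v x - v y <= M * mdist x y) /\
    (forall x, re_part (f x : K) - b <= v x <= re_part (f x : K)).
  apply: inf_convolution => // x y; rewrite -re_partB.
  exact: le_trans (le_trans (ler_norm _) (ler_norm_re_part _)) (fM x y).
have [w [wM uw]] : exists w : X -> R,
    (forall x y, w x - w y <= M * mdist x y) /\
    (forall x, im_part (f x : K) - b <= w x <= im_part (f x : K)).
  apply: inf_convolution => // x y; rewrite -im_partB.
  exact: le_trans (le_trans (ler_norm _) (ler_norm_im_part _)) (fM x y).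
pose g x : K^o := of_parts (v x - v o) (w x - w o) : K.
have gM x y : modulus (g x - g y : K) <= 2 * M * mdist x y.
  rewrite /g of_partsB; apply: le_trans (ler_modulus_parts _ _) _.
  have vxy : `|v x - v o - (v y - v o)| <= M * mdist x y.
    have := vM x y; have := vM y x; rewrite (metric_sym y x) ler_norml.
    by move=> ? ?; apply/andP; split; lra.
  have wxy : `|w x - w o - (w y - w o)| <= M * mdist x y.
    have := wM x y; have := wM y x; rewrite (metric_sym y x) ler_norml.
    by move=> ? ?; apply/andP; split; lra.
  by have := lerD vxy wxy; lra.
have gl : g \in @lipschitz0 R k X o.
  apply/asboolP; split; last by exists (2 * M).
  by rewrite /g !subrr -(subrr (0 : R)) -of_partsB subrr.
exists (Lip0 gl); split => // x /=.
have fo := lip0_at_base f.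
rewrite -[f x : K]subr0 -fo -(of_partsK (f x - f o : K)) re_partB im_partB.
rewrite /g of_partsB; apply: le_trans (ler_modulus_parts _ _) _.
have := uv x; have := uv o; have := uw x; have := uw o.
move=> /andP[? ?] /andP[? ?] /andP[? ?] /andP[? ?].
rewrite (_ : 2 * b = b + b); last by ring.
by apply: lerD; rewrite ler_norml; apply/andP; split; lra.
Qed.

Lemma slope_leP (f : L0) (r : R) :
  (forall p, offdiag p -> slope f p <= r) <->
  (forall x y, modulus (f x - f y : K) <= r * mdist x y).
Proof.
split=> [fr x y|fr p pd]; last first.
  by rewrite /slope ler_pdivrMr// mdist_gt0; apply/eqP.
have [->|/eqP xy] := eqVneq x y; first by rewrite subrr modulus0 mdistxx mulr0.
have := fr (x, y) xy; rewrite /slope ler_pdivrMr//= mdist_gt0.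
exact/eqP.
Qed.

(** The increments of a sequence of approximations of [f] with Lipschitz
    constants of order [2^n] and errors of order [delta n] have Lipschitz
    constants of order [2^n] too, and errors governed by [delta n] and
    [delta n.+1]; this is why [delta n] must be below both [eta n] and
    [eta n.+1].  With [c <= 8^-1] each of the two errors in an increment is at
    most a quarter of the radius allowed.  The first term is a part of [f] that
    is only controlled by the uniform norm of [f], whence the last hypothesis. *)
Lemma mixed_set_telescope (U : nat -> set L0) (eta delta : nat -> R) (c : R)
    (f : L0) :
  (forall n (g : L0), (forall x, modulus (g x : K) < eta n) -> U n g) ->
  (forall n, 0 < delta n <= Num.min (eta n) (eta n.+1)) ->
  0 < c <= 8^-1 ->
  (forall n x y,
    modulus (f x - f y : K) <= c * (2 ^+ n * mdist x y + delta n)) ->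
  (forall x, modulus (f x : K) < eta 0%N / 2) ->
  mixed_set U f.
Proof.
move=> etaU delta_eta /andP[c0 c8] fc f0.
have deltaP n : [/\ 0 < delta n, delta n <= eta n & delta n <= eta n.+1].
  by have /andP[? ] := delta_eta n; rewrite le_min => /andP[? ?]; split.
have approx n : exists g : L0,
    [/\ forall x y, modulus (g x - g y : K) <= 2 * c * 2 ^+ n * mdist x y,
        forall x, modulus (f x - g x : K) <= 2 * c * delta n &
        (forall x y, modulus (f x - f y : K) <= 2 * c * 2 ^+ n * mdist x y) ->
        g = f].
  (* Taking [f] itself as soon as its Lipschitz constant allows it makes the
     sequence of approximations reach [f]. *)
  have [fn|fn] := pselect
      (forall x y, modulus (f x - f y : K) <= 2 * c * 2 ^+ n * mdist x y).
    exists f; split => // x; rewrite subrr modulus0.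
    have [? _ _] := deltaP n.
    by rewrite !mulr_ge0// ltW.
  have [||g [gM fg]] := @lip0_lipschitz_approx f (c * 2 ^+ n) (c * delta n).
  - by rewrite mulr_ge0// ?exprn_ge0// ltW.
  - by move=> x y; rewrite -mulrA -mulrDr.
  - exists g; split => // [x y|x]; rewrite -!mulrA.
      by rewrite [c * _]mulrA mulrA; exact: gM.
    exact: fg.
have [F FP] := choice approx.
have [L L_ge0 /slope_leP fL] := slope_bounded f.
have c2 : 0 < 2 * c by rewrite mulr_gt0.
have [N LN] : exists N, L <= 2 * c * 2 ^+ N.
  have [|N LN] := @exp2_cofinal R (L / (2 * c)).
    by rewrite divr_ge0// ltW.
  by exists N; rewrite mulrC -ler_pdivrMr.
have FN : F N = f.
  have [_ _ ->] := FP N; first by [].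
  by move=> x y; apply: le_trans (fL x y) _; rewrite ler_wpM2r ?mdist_ge0.
pose g i := if i is j.+1 then F j.+1 - F j else F 0%N.
have sum_g n : F n = \sum_(i < n.+1) g i.
  elim: n => [|n IH]; first by rewrite big_ord1.
  by rewrite big_ord_recr /= -IH addrC subrK.
exists N => //; exists g; last by rewrite -sum_g FN.
move=> i _; split.
  apply: etaU => x; case: i => [|i] /=.
    have [_ /(_ x) F0 _] := FP 0%N; have := f0 x; have [d0 d1 _] := deltaP 0%N.
    rewrite -[F 0%N x : K](subKr (f x : K)) => fx.
    apply: le_lt_trans (ler_modulusB _ _) _.
    have : 2 * c * delta 0%N <= eta 0%N / 4 by nra.
    lra.
  have [_ /(_ x) F0 _] := FP i; have [_ /(_ x) F1 _] := FP i.+1.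
  have [d0 _ d1] := deltaP i; have [d2 d3 _] := deltaP i.+1.
  apply: le_lt_trans (ler_modulus_dist (f x) (F i.+1 x) (F i x)) _.
  have : 2 * c * delta i <= eta i.+1 / 4 by nra.
  have : 2 * c * delta i.+1 <= eta i.+1 / 4 by nra.
  lra.
apply/lip0_ballZP/slope_leP => x y; case: i => [|i] /=.
  have [/(_ x y) F0 _ _] := FP 0%N; apply: le_trans F0 _.
  by rewrite ler_wpM2r ?mdist_ge0// !expr0; lra.
have [/(_ x y) F0 _ _] := FP i; have [/(_ x y) F1 _ _] := FP i.+1.
apply: le_trans (ler_modulusBB (F i.+1 x) (F i x) (F i.+1 y) (F i y)) _.
apply: le_trans (lerD F1 F0) _.
rewrite -mulrDl ler_wpM2r ?mdist_ge0// exprS.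
have : 0 <= 2 ^+ i :> R by rewrite exprn_ge0.
by nra.
Qed.


End lip0_topologies.

(** * A weight vanishing at zero with prescribed rate *)

Section weight.
Context {R : realType} (delta : nat -> R).
Hypothesis delta_gt0 : forall n, 0 < delta n.

Definition weight_term n (t : R) := t / (2 ^+ n * t + delta n).

(** The quotient of [t] by the modulus of continuity
    [t |-> inf_n (2 ^+ n * t + delta n)]. *)
Definition weight (t : R) := sup [set weight_term n t | n in [set: nat]].

Lemma weight_term_ge0 n t : 0 <= t -> 0 <= weight_term n t.
Proof.
by move=> t0; rewrite divr_ge0// addr_ge0 ?mulr_ge0 ?exprn_ge0// ltW.
Qed.

Lemma weight_term_le n t : 0 <= t -> weight_term n t <= 2 ^- n.
Proof.
move=> t0; have := delta_gt0 n; have n0 : 0 < 2 ^+ n :> R by rewrite exprn_gt0.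
move=> d0; rewrite /weight_term ler_pdivrMr.
  by rewrite mulrDr mulKf ?gt_eqF// lerDl mulr_ge0 ?invr_ge0 ?ltW.
by rewrite ltr_wpDl// mulr_ge0// ltW.
Qed.

Lemma weight_term_le_weight n t : 0 <= t -> weight_term n t <= weight t.
Proof.
move=> t0; apply: ub_le_sup; last by exists n.
exists 1 => _ [m _ <-]; apply: le_trans (weight_term_le m t0) _.
by rewrite invf_le1 ?exprn_gt0// exprn_ege1// ler1n.
Qed.

Lemma weight_ge0 t : 0 <= t -> 0 <= weight t.
Proof.
move=> t0.
exact: le_trans (weight_term_ge0 0 t0) (weight_term_le_weight 0 t0).
Qed.

(** The bound does not depend on [n], so it passes to the supremum and makes
    it continuous away from zero. *)
Lemma weight_term_lipschitz n (s t : R) : 0 < s -> 0 <= t ->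
  `|weight_term n t - weight_term n s| <= `|t - s| / s.
Proof.
move=> s0 t0; have d0 := delta_gt0 n.
have n1 : 1 <= 2 ^+ n :> R by rewrite exprn_ege1// ler1n.
set a := 2 ^+ n in n1 *.
have a0 : 0 < a by exact: lt_le_trans n1.
have ns : 0 < a * s + delta n by rewrite ltr_wpDl// mulr_ge0// ltW.
have nt : 0 < a * t + delta n by rewrite ltr_wpDl// mulr_ge0// ltW.
have -> : weight_term n t - weight_term n s =
    (t - s) * (delta n / ((a * t + delta n) * (a * s + delta n))).
  by rewrite /weight_term -/a; field; rewrite !gt_eqF.
rewrite normrM ler_wpM2l// ger0_norm; last by rewrite divr_ge0 ?mulr_ge0 ?ltW.
rewrite ler_pdivrMr ?mulr_gt0// mulrC ler_pdivlMr//.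
rewrite ler_pM// ?(ltW s0) ?(ltW d0)//.
  by rewrite lerDr mulr_ge0// ltW.
by rewrite -[leLHS]addr0 lerD ?(ltW d0)// ler_peMl// ltW.
Qed.

Lemma weight_lipschitz (s t : R) : 0 < s -> 0 <= t ->
  `|weight t - weight s| <= `|t - s| / s.
Proof.
move=> s0 t0; have ts0 : 0 <= `|t - s| / s by rewrite divr_ge0// ltW.
rewrite ler_distl; apply/andP; split.
  rewrite lerBlDr; apply: Defs.sup_le; first by rewrite addr_ge0// weight_ge0.
  move=> _ [n _ <-]; have := weight_term_lipschitz n s0 t0.
  rewrite ler_distl => /andP[+ _]; rewrite lerBlDr => /le_trans; apply.
  by rewrite lerD2r weight_term_le_weight.
apply: Defs.sup_le; first by rewrite addr_ge0// weight_ge0// ltW.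
move=> _ [n _ <-]; have := weight_term_lipschitz n s0 t0.
rewrite ler_distl => /andP[_ /le_trans]; apply.
by rewrite lerD2r weight_term_le_weight// ltW.
Qed.

(** Only finitely many terms exceed [e / 2] somewhere, since the [n]-th is at
    most [2 ^- n]; each of those is at most [t / delta n], which tends to zero
    with [t]. *)
Lemma weight_vanishes (e : R) : 0 < e ->
  exists2 s : R, 0 < s & forall t, 0 <= t < s -> weight t < e.
Proof.
move=> e0; have e2 : 0 < e / 2 by rewrite divr_gt0.
have [N Ne] : exists N, 2 ^- N <= e / 2.
  have [|N Ne] := @exp2_cofinal R (e / 2)^-1; first by rewrite invr_ge0 ltW.
  by exists N; rewrite -[leRHS]invrK lef_pV2 ?posrE ?exprn_gt0 ?invr_gt0.
have [s s0 sN] : exists2 s : R, 0 < s &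
    forall n, (n < N)%N -> s <= delta n * (e / 2).
  elim: N {Ne} => [|N [s s0 sN]]; first by exists 1.
  exists (Num.min s (delta N * (e / 2))); first by rewrite lt_min s0 mulr_gt0.
  move=> n; rewrite ltnS leq_eqVlt => /orP[/eqP->|nN].
    by rewrite ge_min lexx orbT.
  by rewrite ge_min sN.
exists s => // t /andP[t0 ts]; apply: (@le_lt_trans _ _ (e / 2)); last by lra.
apply: Defs.sup_le; [exact: ltW|move=> _ [n _ <-]].
have [nN|nN] := ltnP n N; last first.
  apply: le_trans (weight_term_le n t0) _; apply: le_trans Ne.
  by rewrite lef_pV2 ?posrE ?exprn_gt0// ler_weXn2l// ler1n.
rewrite /weight_term ler_pdivrMr; last first.
  by rewrite ltr_wpDl// mulr_ge0// exprn_ge0.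
rewrite mulrDr [e / 2 * delta n]mulrC.
apply: le_trans (ltW ts) (le_trans (sN n nN) _).
by rewrite lerDr !mulr_ge0// ?exprn_ge0// ltW.
Qed.

End weight.

(** * Pairs of distinct points of a compact metric space *)

Section metric_offdiag.
Context {R : realType} {X : metricType R}.
Local Notation D := (@offdiag R X).

Lemma cvg_mdist (p : X * X) : mdist q.1 q.2 @[q --> p] --> mdist p.1 p.2.
Proof.
apply/cvgrPdist_lt => /= e e0; have e2 : 0 < e / 2 by rewrite divr_gt0.
exists (ball p.1 (e / 2), ball p.2 (e / 2)); first by split; exact: nbhsx_ballx.
move=> q [/=]; rewrite !ballEmdist/= => pq1 pq2.
have := metric_triangle p.1 q.1 p.2; have := metric_triangle q.1 q.2 p.2.
have := metric_triangle q.1 p.1 q.2; have := metric_triangle p.1 p.2 q.2.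
rewrite (metric_sym q.2 p.2) (metric_sym q.1 p.1) => ? ? ? ?.
by rewrite ltr_norml; apply/andP; split; lra.
Qed.

Lemma mdist_bounded (o : X) : compact [set: X] ->
  exists2 d : R, 0 <= d & forall x, mdist x o <= d.
Proof.
move=> cX; have cd : {within [set: X], continuous (fun x => mdist x o)}.
  apply: continuous_subspaceT => x.
  apply: (@cvg_comp _ _ _ (fun y => (y, o)) (fun p : X * X => mdist p.1 p.2)
    _ (nbhs (x, o))).
    apply: (@cvg_pair _ _ _ _ (nbhs x) (nbhs o)); first exact: cvg_id.
    exact: cvg_cst.
  exact: cvg_mdist.
have [c _ co] := compact_EVT_max (ex_intro _ o I) cX cd.
by exists (mdist c o) => [|x]; [exact: mdist_ge0|exact/co/mem_set].
Qed.

Lemma continuous_offdiag_mdist :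
  continuous (fun p : D => mdist (\val p).1 (\val p).2).
Proof.
move=> p; apply: (@cvg_comp _ _ _ (\val : D -> X * X)
  (fun q : X * X => mdist q.1 q.2) _ (nbhs (\val p))).
  exact: (@initial_continuous D (X * X)%type set_val).
exact: cvg_mdist.
Qed.

(** These pairs form a closed subset of the compact space [X * X] that avoids
    the diagonal, so a cluster point found in [X * X] is still one among the
    pairs of distinct points. *)
Lemma compact_offdiag_mdist_ge (s : R) : compact [set: X] -> 0 < s ->
  compact [set p : D | s <= mdist (\val p).1 (\val p).2].
Proof.
move=> cX s0; pose S := [set p : X * X | s <= mdist p.1 p.2].
have cS : compact S.
  apply: (@subclosed_compact _ _ [set: X * X]) => //.
    apply: (@preimage_closed _ _ (fun p : X * X => mdist p.1 p.2)
      [set x | s <= x]).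
      by move=> p _; exact: cvg_mdist.
    exact: closed_ge.
  by rewrite -setXTT; exact: compact_setX.
move=> F FF FS; have [p [Sp Fp]] : S `&` cluster (\val @ F) !=set0 by exact: cS.
have pD : D p by move=> pp; move: Sp; rewrite /S /= pp mdistxx leNgt s0.
exists (SigSub (mem_set pD)); split => // A B FA [_ [[B' oB' <-] B'p] B'B].
have [_ [[q Aq <-] B'q]] : (\val @` A) `&` B' !=set0.
  apply: Fp; last exact: open_nbhs_nbhs.
  have sA : A `<=` \val @^-1` (\val @` A) by move=> q Aq; exists q.
  exact: filterS sA FA.
by exists q; split => //; exact: B'B.
Qed.

Lemma compact_offdiag_mdist_gt0 (C : set D) : compact C ->
  exists2 r : R, 0 < r & forall p, C p -> r <= mdist (\val p).1 (\val p).2.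
Proof.
move=> cC; have [C0|/set0P C0] := eqVneq C set0.
  by exists 1 => // p; rewrite C0.
have cd : {within C, continuous (fun p : D => mdist (\val p).1 (\val p).2)}.
  exact/continuous_subspaceT/continuous_offdiag_mdist.
have [c _ cle] := compact_EVT_min C0 cC cd.
exists (mdist (\val c).1 (\val c).2); last by move=> p Cp; exact/cle/mem_set.
by rewrite mdist_gt0; apply/eqP; exact: (set_valP c).
Qed.

End metric_offdiag.

Section C0_weight.
Context {R : realType} {k : scalar_kind}.
Local Notation K := (scalars R k).

Lemma continuous_modulusP (T : topologicalType) (f : T -> K) :
  (forall x (e : R), 0 < e -> \forall y \near x, modulus (f y - f x) < e) ->
  continuous f.
Proof.
move=> fe x A /nbhs_ballP[e /= e0 eA].
have me : 0 < modulus e.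
  by rewrite -(of_real_lt (k := k)) of_real0 -normE normr_gt0 gt_eqF.
apply: filterS (fe x _ me) => y xy; apply: eA.
by rewrite /ball/= -(gtr0_norm e0) distrC !normE of_real_lt.
Qed.

Lemma of_realB (r s : R) : of_real (r - s) = of_real r - of_real s :> K.
Proof.
apply/(@addIr _ (of_real s)).
by rewrite subrK -of_realD subrK.
Qed.

Lemma C0_offdiag_weight (X : metricType R) (delta : nat -> R) :
    compact [set: X] -> (forall n, 0 < delta n) ->
  @C0_offdiag R k X
    (fun p => of_real (weight delta (mdist (\val p).1 (\val p).2))).
Proof.
move=> cX d0; split.
  apply: continuous_modulusP => p e e0.
  have p0 : 0 < mdist (\val p).1 (\val p).2.
    by rewrite mdist_gt0; apply/eqP; exact: (set_valP p).
  have pe : 0 < e * mdist (\val p).1 (\val p).2 by rewrite mulr_gt0.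
  have : (fun q : @offdiag R X => mdist (\val q).1 (\val q).2) @ p -->
      mdist (\val p).1 (\val p).2.
    exact: continuous_offdiag_mdist.
  move=> /cvgrPdist_lt /(_ _ pe); apply: filterS => q pq.
  rewrite -of_realB modulus_of_real.
  apply: le_lt_trans (weight_lipschitz d0 p0 (mdist_ge0 _ _)) _.
  by rewrite ltr_pdivrMr// distrC.
move=> e e0; have [s s0 se] := weight_vanishes d0 e0.
exists [set p | s <= mdist (\val p).1 (\val p).2].
  exact: compact_offdiag_mdist_ge.
move=> p /negP; rewrite -ltNge => ps.
rewrite modulus_of_real ger0_norm ?weight_ge0 ?mdist_ge0//.
by apply: se; rewrite mdist_ge0.
Qed.

End C0_weight.

(** * Comparison of the two topologies *)

Section comparison.
Context {R : realType} (k : scalar_kind) {X : metricType R} (o : X).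
Hypothesis cX : compact [set: X].
Local Notation K := (scalars R k).
Local Notation L0 := (lip0 k o).

Lemma nbhs0_compact_openP (U : set L0) :
  nbhs (0 : lip0_compact_open k o) U <->
  exists2 e : R, 0 < e &
    forall g : L0, (forall x, modulus (g x : K) < e) -> U g.
Proof.
split=> [|[e e0 eU]].
  pose F : set_system L0 := filter_from [set e : R | 0 < e]
    (fun e => [set g : L0 | forall x, modulus (g x : K) < e]).
  have FF : Filter F.
    apply: filter_from_filter; first by exists 1; exact: ltr01.
    move=> a b /= a0 b0; exists (Num.min a b); first by rewrite /= lt_min a0.
    by move=> g gab; split=> x; have := gab x; rewrite lt_min => /andP[].
  move=> nU; suff [e e0 eU] : F U by exists e.
  apply: (@compact_open_nbhs0 R k X o L0 F id U FF _ nU).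
  move=> C O cC oO C0.
  have [CE|/set0P/C0 O0] := eqVneq C set0.
    by exists 1 => [|g _ x]; [exact: ltr01|rewrite CE].
  have /nbhs_ballP[e /= e0 eO] : nbhs (0 : K) O by exact: open_nbhs_nbhs.
  exists (modulus e).
    by rewrite /= -(of_real_lt (k := k)) of_real0 -normE normr_gt0 gt_eqF.
  move=> g ge x _; apply: eO; rewrite /ball/= sub0r normrN normE.
  by rewrite -(gtr0_norm e0) normE of_real_lt.
have oe : open [set z : K | modulus z < e].
  rewrite openE => z /= ze; rewrite /interior /=.
  apply: filterS (near_modulus z (_ : 0 < e - modulus z)); last first.
    by rewrite subr_gt0.
  move=> y yz /=; rewrite -[y](subrK z) (le_lt_trans (ler_modulusD _ _))//.
  by rewrite -ltrBrDr.
exists (@lip0_fun R k X o @^-1`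
  [set g | g @` [set: X] `<=` [set z : K | modulus z < e]]); split.
- by eexists; first exact: (compact_open_open cX oe).
- by move=> _ [x _ <-] /=; rewrite modulus0.
- by move=> g ge; apply: eU => x; apply: ge; exists x.
Qed.

(** On the ball of radius [2 ^+ n], the strict topology is no finer at zero
    than uniform convergence: where phi is not small, the distance is bounded
    below and slopes are controlled by values. *)
Lemma strict_seminorm_le_on_ball (phi : @offdiag R X -> K) (n : nat)
    (e : R) :
  C0_offdiag phi -> 0 < e ->
  exists2 r : R, 0 < r & forall g : L0, (forall x, modulus (g x : K) < r) ->
    (forall p, offdiag p -> slope g p <= 2 ^+ n) -> strict_seminorm phi g <= e.
Proof.
move=> C0phi e0; have [M M0 phiM] := C0_bounded C0phi.
have [_ /(_ (e / 2 ^+ n))[|C cC Ce]] := C0phi.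
  by rewrite divr_gt0// exprn_gt0.
have [r r0 Cr] := compact_offdiag_mdist_gt0 cC.
have M1 : 0 < M + 1 by rewrite ltr_wpDl.
exists (e * r / (2 * (M + 1))); first by rewrite divr_gt0 ?mulr_gt0.
move=> g gr gn; apply: Defs.sup_le; [exact: ltW|move=> _ [p _ <-]].
have [Cp|nCp] := pselect (C p); last first.
  rewrite -(divfK (lt0r_neq0 (exprn_gt0 n (@ltr0Sn R 1))) e).
  rewrite ler_pM ?modulus_ge0 ?slope_ge0 ?(ltW (Ce _ nCp))//.
  exact: gn (set_valP p).
have : slope g (\val p) <= e / (M + 1).
  have p0 : 0 < mdist (\val p).1 (\val p).2 by apply: lt_le_trans (Cr p Cp).
  rewrite /slope ler_pdivrMr//.
  apply: le_trans (ler_modulusB _ _) _.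
  apply: le_trans (lerD (ltW (gr _)) (ltW (gr _))) _.
  have -> : e * r / (2 * (M + 1)) + e * r / (2 * (M + 1)) = e / (M + 1) * r.
    by field; rewrite gt_eqF.
  by rewrite ler_wpM2l ?divr_ge0 ?(ltW e0) ?(ltW M1)//; exact: Cr.
move=> /(ler_pM (modulus_ge0 _) (slope_ge0 _ _) (phiM p)) /le_trans; apply.
by rewrite mulrCA ler_piMr ?(ltW e0)// ler_pdivrMr// mul1r lerDl.
Qed.

(** The errors [e / 2 ^+ n.+2] allowed on the successive summands add up to at
    most [e / 2]. *)
Lemma mixed_nbhs0_strict_seminorm (phi : @offdiag R X -> K) (e : R) :
  C0_offdiag phi -> 0 < e ->
  exists2 W : set L0, mixed_nbhs0 W &
    forall f, W f -> strict_seminorm phi f < e.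
Proof.
move=> C0phi e0.
have rP n : exists r : R, 0 < r /\ forall g : L0,
    (forall x, modulus (g x : K) < r) ->
    (forall p, offdiag p -> slope g p <= 2 ^+ n) ->
    strict_seminorm phi g <= e / 2 ^+ n.+2.
  have [|r r0 rP] :=
      @strict_seminorm_le_on_ball phi n (e / 2 ^+ n.+2) C0phi.
    by rewrite divr_gt0// exprn_gt0.
  by exists r.
have [r {}rP] := choice rP.
pose U n := [set g : L0 | forall x, modulus (g x : K) < r n].
exists (mixed_set U).
  exists U => // n; have [r0 _] := rP n; split.
  - apply/convex_setP => f g t t01 Uf Ug x.
    apply: le_lt_trans (ler_modulusD _ _) _.
    pose M := Num.max (modulus (f x : K)) (modulus (g x : K)).
    have Mr : M < r n by rewrite gt_max Uf Ug.
    apply: le_lt_trans Mr; rewrite !modulusM -[leRHS]mul1r -(modulus_conv t01).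
    by rewrite mulrDl lerD// ler_wpM2l ?modulus_ge0// le_max lexx ?orbT.
  - move=> a f; rewrite -modulus_le1 => a1 Uf x.
    by apply: le_lt_trans (Uf x); rewrite modulusM ler_piMl ?modulus_ge0.
  - by apply/nbhs0_compact_openP; exists (r n).
move=> f [n _ [g gU ->]].
suff : strict_seminorm phi (\sum_(i < n.+1) g i) <= e / 2 - e / 2 ^+ n.+2.
  move=> /le_lt_trans; apply.
  have : 0 < e / 2 ^+ n.+2 by rewrite divr_gt0// exprn_gt0.
  by lra.
have gn i : (i <= n)%N -> strict_seminorm phi (g i) <= e / 2 ^+ i.+2.
  by move=> /gU[Ui /lip0_ballZP gi]; have [_] := rP i; apply.
have sum_g m : (m <= n)%N ->
    strict_seminorm phi (\sum_(i < m.+1) g i) <= e / 2 - e / 2 ^+ m.+2.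
  elim: m => [|m IH] mn.
    rewrite big_ord1; apply: le_trans (gn 0%N mn) _.
    by rewrite expr2; lra.
  rewrite big_ord_recr/=; apply: le_trans (strict_seminormD C0phi _ _) _.
  apply: le_trans (lerD (IH (ltnW mn)) (gn m.+1 mn)) _.
  have -> : 2 ^+ m.+3 = 2 * 2 ^+ m.+2 :> R by exact: exprS.
  move: (2 ^+ m.+2) => q.
  have -> : e / q = 2 * (e / (2 * q)).
    by rewrite invfM mulrCA mulVKf// pnatr_eq0.
  by lra.
exact: sum_g.
Qed.

Lemma strict_nbhs0_mixed (W : set L0) : strict_nbhs0 W ->
  exists2 W' : set L0, mixed_nbhs0 W' & W' `<=` W.
Proof.
move=> [n [phi [e [C0phi e0 ->]]]].
have : nbhs (0 : mixed_lip0 k o)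
    [set f : L0 | forall i, strict_seminorm (phi i) f < e].
  suff H i : nbhs (0 : mixed_lip0 k o)
      [set f : L0 | strict_seminorm (phi i) f < e].
    exact: (filter_forall (nbhs_filter (0 : mixed_lip0 k o)) H).
  have [V mV Ve] := mixed_nbhs0_strict_seminorm (C0phi i) e0.
  by exists V => // f /Ve; rewrite add0r.
by move=> [V mV VW]; exists V => // f /VW /=; rewrite add0r.
Qed.

(** The radius [c] must make the first telescoping term small as well, and the
    values of [f] at distance at most [d] from the base point are bounded by
    [c * (d + delta 0)]; hence the second term of the minimum defining [c]. *)
Lemma mixed_nbhs0_strict (W : set L0) : mixed_nbhs0 W ->
  exists2 W' : set L0, strict_nbhs0 W' & W' `<=` W.
Proof.
move=> [U mU ->].
have etaP n : exists eta : R, 0 < eta /\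
    forall g : L0, (forall x, modulus (g x : K) < eta) -> U n g.
  have [_ _ /nbhs0_compact_openP[eta eta0 etaU]] := mU n.
  by exists eta.
have [eta {}etaP] := choice etaP.
pose delta n := Num.min (eta n) (eta n.+1).
have delta0 n : 0 < delta n.
  by rewrite lt_min; have [-> _] := etaP n; have [-> _] := etaP n.+1.
have [d d0 dP] := mdist_bounded o cX.
have [eta0 _] := etaP 0%N.
have den0 : 0 < 2 * (d + delta 0%N + 1).
  by rewrite mulr_gt0// ltr_wpDl// addr_ge0// ltW.
pose c := Num.min 8^-1 (eta 0%N / (2 * (d + delta 0%N + 1))).
have c0 : 0 < c by rewrite lt_min invr_gt0 ltr0n/= divr_gt0.
pose phi (p : @offdiag R X) : K :=
  of_real (weight delta (mdist (\val p).1 (\val p).2)).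
exists [set f : L0 | forall i : 'I_1, strict_seminorm phi f < c].
  exists 1%N, (fun=> phi), c; split => // _.
  exact: C0_offdiag_weight.
move=> f /(_ ord0) fc.
have fcn n x y : modulus (f x - f y : K) <= c * (2 ^+ n * mdist x y + delta n).
  have [->|/eqP xy] := eqVneq x y.
    rewrite subrr modulus0 mulr_ge0 ?(ltW c0)// mdistxx mulr0 add0r.
    exact: ltW.
  have xy0 : 0 < mdist x y by rewrite mdist_gt0; exact/eqP.
  have xyD : @offdiag R X (x, y) by [].
  have := strict_seminorm_ub (C0_offdiag_weight cX delta0) f
    (SigSub (mem_set xyD)).
  move=> /le_lt_trans /(_ fc) /ltW.
  rewrite modulus_of_real ger0_norm ?weight_ge0 ?mdist_ge0//=.
  have := weight_term_le_weight delta0 n (ltW xy0).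
  move=> /(ler_wpM2r (slope_ge0 f (x, y))) /le_trans /[apply].
  have wn0 : 0 < 2 ^+ n * mdist x y + delta n.
    by rewrite ltr_wpDl// mulr_ge0// ?exprn_ge0// mdist_ge0.
  by rewrite /weight_term /slope/= mulrC mulrA divfK ?gt_eqF// ler_pdivrMr.
have [c8 cd] : c <= 8^-1 /\ c <= eta 0%N / (2 * (d + delta 0%N + 1)).
  by split; rewrite ge_min lexx ?orbT.
apply: (mixed_set_telescope (eta := eta) (delta := delta) (c := c)) => //.
- by move=> n g; have [_] := etaP n; apply.
- by move=> n; rewrite delta0 /=.
- by rewrite c0.
move=> x; rewrite -[f x : K]subr0 -(lip0_at_base f).
apply: le_lt_trans (fcn 0%N x o) _.
rewrite expr0 mul1r; move: cd; rewrite ler_pdivlMr// => cd.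
have : c * (mdist x o + delta 0%N) <= c * (d + delta 0%N).
  by rewrite ler_wpM2l ?(ltW c0)// lerD2r.
by lra.
Qed.

End comparison.

Lemma with_base_open_sub (K : numFieldType) (V : lmodType K)
    (B B' : zero_base V) :
    (forall W, B W -> exists2 W', B' W' & W' `<=` W) ->
  @open (with_base B) `<=` (@open (with_base B') : set (set V)).
Proof.
move=> BB' A; rewrite !openE => oA f Af.
have [W BW WA] := oA f Af; have [W' BW' W'W] := BB' W BW.
by exists W' => // g /W'W/WA.
Qed.

Theorem theorem3p3 (R : realType) (k : scalar_kind) (X : metricType R) (o : X) :
  compact [set: X] ->
  @open (strict_lip0 k o) = @open (mixed_lip0 k o) :> set (set (lip0 k o)).
Proof.
move=> cX; apply/seteqP; split; apply: with_base_open_sub.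
  exact: strict_nbhs0_mixed.
exact: mixed_nbhs0_strict.
Qed.
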